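(* For all integers $k\ge2$ and $r\ge0$ one has $$B_{k,1,r}^2\ge B_{k,1,r-1}\,B_{k,1,r+1}.$$ Equivalently, for every $k\ge2$ the polynomial $A_{k,1}(d)$ is binomially log-concave.
   Context: For integers $k,d\ge0$ let $c_k(2,d)\in\mathbb{Z}[x_1,x_2]$ be the homogeneous degree-$k$ part of $\prod_{i=0}^d(1+ix_1+(d-i)x_2)$. Expand it in two-variable Schur polynomials: $$c_k(2,d)=\sum_{0\le j\le\lfloor k/2\rfloor}A_{k,j}(d)\,s_{(k-j,j)}(x_1,x_2).$$ For fixed $k,j$ with $0\le j\le\lfloor k/2\rfloor$, $A_{k,j}(d)$ is a polynomial function of $d$, and the numbers $B_{k,j,r}$ $(r\ge0)$ are its coefficients in the binomial basis: $A_{k,j}(d)=\sum_{r\ge0}B_{k,j,r}\binom dr$; put $B_{k,j,r}=0$ for $r<0$. A polynomial $f(d)=\sum_{r\ge0}b_r\binom dr$ is called binomially log-concave if the sequence $(b_r)_r$ has no internal zeroes (its support is an interval) and $b_r^2\ge b_{r-1}b_{r+1}$ for all $r$. *)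

(* Defs.v *)
From HB Require Import structures.
From mathcomp Require Import all_boot all_order all_algebra.
From mathcomp Require Import mpoly.

Set Implicit Arguments.
Unset Strict Implicit.
Unset Printing Implicit Defensive.

Import Order.TTheory GRing.Theory Num.Theory.
Local Open Scope ring_scope.

(* A partition is a nonincreasing sequence of naturals, trailing zeros being
   allowed; so its first entry bounds the length of every row. *)
Definition cell (la : seq nat) :=
  {c : 'I_(size la) * 'I_(head 0%N la) | (c.2 < nth 0 la c.1)%N}.

(* Entries weakly increase along rows and strictly increase down columns. *)
Definition semistandard (n : nat) (la : seq nat)
    (T : {ffun cell la -> 'I_n}) : bool :=
  [forall u : cell la, forall v : cell la,
     (((val u).1 == (val v).1) && ((val u).2 <= (val v).2)%N
        ==> (T u <= T v)%N)
  && (((val u).2 == (val v).2) && ((val u).1 < (val v).1)%N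
        ==> (T u < T v)%N)].

Definition schur (n : nat) (R : comNzRingType) (la : seq nat) : {mpoly R[n]} :=
  \sum_(T : {ffun cell la -> 'I_n} | semistandard T) \prod_(u : cell la) 'X_(T u).

Definition x1 : {mpoly int[2]} := 'X_ord0.
Definition x2 : {mpoly int[2]} := 'X_ord_max.

Definition chern (k d : nat) : {mpoly int[2]} :=
  pihomog mdeg k (\prod_(i < d.+1) (1 + x1 *+ i + x2 *+ (d - i))).

(* The coefficients in the Schur expansion are given by polynomials a_j in d;
   these take integer values but have rational coefficients, hence the change
   of scalars from int to rat. *)
Definition schur_coefficients (k : nat) (a : nat -> {poly rat}) : Prop :=
  forall d : nat,
    map_mpoly intr (chern k d) =
    \sum_(j < k./2.+1) (a j).[d%:R] *: schur 2 rat [:: (k - j)%N; j : nat].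

Definition binomial_poly (r : nat) : {poly rat} :=
  (r`!%:R)^-1 *: \prod_(i < r) ('X - i%:R%:P).

(* Coefficients are indexed by int, so that b_{r-1} makes sense for r = 0. *)
Definition binomial_coefficients (f : {poly rat}) (b : int -> rat) : Prop :=
  (forall r : int, r < 0 -> b r = 0) /\
  exists n : nat,
    (forall r : nat, (n <= r)%N -> b r%:Z = 0) /\
    f = \sum_(r < n) b r%:Z *: binomial_poly r.

Definition no_internal_zeroes (b : int -> rat) : Prop :=
  forall i j l : int, i <= j -> j <= l -> b i != 0 -> b l != 0 -> b j != 0.

Definition binomially_log_concave (f : {poly rat}) : Prop :=
  exists b : int -> rat,
    [/\ binomial_coefficients f b,
        no_internal_zeroes b
      & forall r : int, b (r - 1) * b (r + 1) <= b r ^+ 2].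

(* Main.v *)
Require Import Defs.
From mathcomp Require Import all_boot all_order all_algebra.
From mathcomp Require Import mpoly.
From mathcomp Require Import zify ring lra.

Import Order.TTheory GRing.Theory Num.Theory.
Local Open Scope ring_scope.

(* For k = K + 2, comparing the coefficients of x_1^k and x_1^(k-1) x_2 gives
   A_{k,1}(d) = d (d - K) e_{K+1}(1..d) - (K+3) e_{K+2}(1..d).  In the binomial
   basis, e_{K+1}(1..d) has coefficients v_{s} + v_{s-1} at r = K+1+s, where v is
   a row of associated Stirling numbers of the first kind; v is log-concave
   because v_{j+1}(s) = (s+j+2) (v_j(s) + v_j(s-1)).  With generating functions
   V = sum v_s t^s and theta = t d/dt, this makes the generating function of
   B_{k,1,r} equal to t^(k-1) (1+t) U with
   U = (1+t) theta (theta+k) ((1+t) V) + (k-1) V.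
   The coefficients of U are combinations of three consecutive v's with quadratic
   weights, and this operator preserves log-concavity, because U_s^2 - U_{s-1} U_{s+1}
   is a combination with nonnegative weights of the differences
   v_i v_j - v_{i-1} v_{j+1} (i <= j) and of products v_i v_j. *)

(** * Log-concave sequences supported on an interval *)

(** Fixing the support as exactly [[0, n)] rules out internal zeros; positivity there permits the
    cancellations in the gap lemmas. *)
Definition log_concave_on (n : nat) (w : int -> rat) : Prop :=
  [/\ forall s, 0 <= w s,
      forall s, (w s != 0) = (0 <= s < n%:Z)
    & forall s, w (s - 1) * w (s + 1) <= w s ^+ 2].

(** Multiply the inequalities at [s] and [s + 1] and cancel [w s * w (s + 1)], which is positive
    once both outer entries are nonzero. *)
Lemma log_concave_on_gap3 {n w} : log_concave_on n w ->
  forall s, w (s - 1) * w (s + 2) <= w s * w (s + 1).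
Proof.
case=> w0 wn wlc s.
have [e1|n1] := eqVneq (w (s - 1)) 0; first by rewrite e1 mul0r mulr_ge0.
have [e2|n2] := eqVneq (w (s + 2)) 0; first by rewrite e2 mulr0 mulr_ge0.
rewrite wn in n1; rewrite wn in n2.
have b0 : 0 < w s by rewrite lt_def w0 wn andbT; lia.
have c0 : 0 < w (s + 1) by rewrite lt_def w0 wn andbT; lia.
have h1 := wlc s; have h2 := wlc (s + 1).
rewrite addrK -addrA in h2.
rewrite -(ler_pM2l (mulr_gt0 b0 c0)).
have := ler_pM (mulr_ge0 (w0 _) (w0 _)) (mulr_ge0 (w0 _) (w0 _)) h1 h2.
by congr (_ <= _); ring.
Qed.

(** The inequalities at [s - 1] and [s + 1] bound [w s ^+ 2] times the left side by the square of
    the right side; the one at [s] turns one factor of that square into [w s ^+ 2], which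
    cancels. *)
Lemma log_concave_on_gap4 {n w} : log_concave_on n w ->
  forall s, w (s - 2) * w (s + 2) <= w (s - 1) * w (s + 1).
Proof.
case=> w0 wn wlc s.
have [e1|n1] := eqVneq (w (s - 2)) 0; first by rewrite e1 mul0r mulr_ge0.
have [e2|n2] := eqVneq (w (s + 2)) 0; first by rewrite e2 mulr0 mulr_ge0.
rewrite wn in n1; rewrite wn in n2.
have b0 : 0 < w (s + 1) by rewrite lt_def w0 wn andbT; lia.
have c0 : 0 < w s by rewrite lt_def w0 wn andbT; lia.
have e0 : 0 < w (s - 1) by rewrite lt_def w0 wn andbT; lia.
have h1 := wlc (s - 1); have h2 := wlc (s + 1); have h3 := wlc s.
rewrite addrK -addrA in h2; rewrite subrK -addrA -opprD in h1.
have := ler_pM (mulr_ge0 (w0 _) (w0 _)) (mulr_ge0 (w0 _) (w0 _)) h1 h2.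
move=> h4; have {}h4 : w s ^+ 2 * (w (s - 2) * w (s + 2))
    <= (w (s - 1) * w (s + 1)) * (w (s - 1) * w (s + 1)).
  by move: h4; congr (_ <= _); ring.
rewrite -(ler_pM2l (exprn_gt0 2 c0)); apply: le_trans h4 _.
by rewrite ler_pM2r // mulr_gt0.
Qed.

(** Multiplication of the generating function by 1 + t. The new difference at [s] is the sum of the
    old ones at [s] and [s - 1] and of the gap-3 difference at [s - 1]. *)
Lemma log_concave_on_add_shift n w : (0 < n)%N -> log_concave_on n w ->
  log_concave_on n.+1 (fun s => w s + w (s - 1)).
Proof.
move=> n0 wlcn; have [w0 wn wlc] := wlcn; split=> s.
- exact: addr_ge0.
- by rewrite paddr_eq0 // negb_and !wn; lia.
have h1 := wlc s; have h2 := wlc (s - 1).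
have h3 := log_concave_on_gap3 wlcn (s - 1).
rewrite (_ : s - 1 + 2 = s + 1) ?subrK ?addrK in h2 h3 *; last by lia.
have := mulr_ge0 (w0 s) (w0 (s - 1)); lra.
Qed.

Lemma log_concave_on_scale n w (c : int -> rat) :
  (forall s, 0 <= s -> 0 < c s) ->
  (forall s, 0 < s -> c (s - 1) * c (s + 1) <= c s ^+ 2) ->
  log_concave_on n w -> log_concave_on n (fun s => c s * w s).
Proof.
move=> c0 clc [w0 wn wlc].
have w_lt0 s : s < 0 -> w s = 0.
  by move=> s0; apply/eqP; rewrite -[_ == _]negbK wn; lia.
split=> s.
- have [s0|s0] := ltP s 0; first by rewrite w_lt0 // mulr0.
  by rewrite mulr_ge0 // ltW // c0.
- have [s0|s0] := ltP s 0; first by rewrite w_lt0 // mulr0 eqxx; lia.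
  by rewrite mulf_eq0 (gt_eqF (c0 s s0)) wn s0.
have [s0|s0] := leP s 0.
  by rewrite w_lt0 1?mulr0 ?mul0r ?sqr_ge0 //; lia.
rewrite exprMn mulrACA ler_pM ?mulr_ge0 ?clc //; apply/ltW/c0; lia.
Qed.

(** * The quadratic window operator *)

(** Here [a], [b], [c], [e], [f] stand for [w (s + 1)] down to [w (s - 3)], and [u] for s + k - 1;
    the linear forms are the windows at [s - 1], [s + 1] and [s]. *)
Lemma quadratic_window_ineq (R : realFieldType) (s u a b c e f : R) :
  2 <= s -> 1 <= u -> 0 <= a -> 0 <= b -> 0 <= c -> 0 <= e -> 0 <= f ->
  c * a <= b ^+ 2 -> e * b <= c ^+ 2 -> f * c <= e ^+ 2 ->
  e * a <= c * b -> f * b <= e * c -> f * a <= e * b ->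
  (s * (u - 1) * c + ((s - 1) * u + (s - 2) * (u - 1)) * e
     + (s - 2) * (u - 1) * f) *
  ((s + 2) * (u + 1) * a + ((s + 1) * (u + 2) + s * (u + 1)) * b
     + s * (u + 1) * c)
  <= ((s + 1) * u * b + (s * (u + 1) + (s - 1) * u) * c + (s - 1) * u * e) ^+ 2.
Proof.
move=> s2 u1 a0 b0 c0 e0 f0 ca eb fc ea fb fa.
have [s0 u0] : 0 <= s /\ 0 <= u by lra.
have [s1 s2'] : 0 <= s - 1 /\ 0 <= s - 2 by lra.
have [u1' sp] : 0 <= u - 1 /\ 0 <= s + 1 by lra.
have [sp2 up] : 0 <= s + 2 /\ 0 <= u + 1 by lra.
have up2 : 0 <= u + 2 by lra.
have su : 0 <= s * u by rewrite mulr_ge0.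
set pm := s * (u - 1).
have pm0 : 0 <= pm by rewrite mulr_ge0.
set qm := (s - 1) * u + (s - 2) * (u - 1).
have qm0 : 0 <= qm by rewrite addr_ge0 ?mulr_ge0.
set mm := (s - 2) * (u - 1).
have mm0 : 0 <= mm by rewrite mulr_ge0.
set pp := (s + 2) * (u + 1).
have pp0 : 0 <= pp by rewrite mulr_ge0.
set qp := (s + 1) * (u + 2) + s * (u + 1).
have qp0 : 0 <= qp by rewrite addr_ge0 ?mulr_ge0.
set mp := s * (u + 1).
have mp0 : 0 <= mp by rewrite mulr_ge0.
set p := (s + 1) * u; set q := mp + (s - 1) * u; set m := (s - 1) * u.
have m0 : 0 <= m by rewrite mulr_ge0.
have [ss uu] : 0 <= s * (s - 2) /\ 0 <= u ^+ 2 by rewrite mulr_ge0 ?sqr_ge0.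
(* The next claims sign the coefficients of the final grouping; apart from [ccc], they become linear
   facts in terms of [u ^+ 2] and [s * (s - 2)]. *)
have cbb : 0 <= p ^+ 2 - pp * pm.
  by rewrite (_ : _ - _ = u ^+ 2 + s * (s - 2) + 4 * s);
    [lra | rewrite /p /pp /pm; ring].
have cee : 0 <= m ^+ 2 - mp * mm.
  by rewrite (_ : _ - _ = u ^+ 2 + s * (s - 2)); [lra | rewrite /m /mp /mm; ring].
have cbc : 0 <= 2 * p * q - pp * qm - qp * pm.
  rewrite (_ : _ - _ = 4 * u ^+ 2 + 4 * (s * (s - 2)) + 2 * u + 10 * s - 4).
    by lra.
  by rewrite /p /q /pp /qm /qp /pm /m /mp; ring.
have cce : 0 <= 2 * q * m - mp * qm - qp * mm.
  rewrite (_ : _ - _ = 4 * u ^+ 2 + 4 * (s * (s - 2)) + 2 * u + 2 * s - 4).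
    by lra.
  by rewrite /q /m /qm /qp /mp /mm; ring.
have ccc : 0 <= q ^+ 2 - mp * pm.
  (* A difference of squares: [mp * pm] is (s u)^2 - s^2, and [q] - s u = s + [m]. *)
  rewrite (_ : _ - _ = (s + m) * (s * u + mp + m) + s * s).
    have [h1 h2] : 0 <= s + m /\ 0 <= s * u + mp + m by rewrite !addr_ge0.
    by rewrite addr_ge0 // mulr_ge0.
  by rewrite /q /mp /pm /m; ring.
have cbe : 0 <= q ^+ 2 + 2 * p * m - mp * pm - pp * mm - qp * qm.
  rewrite (_ : _ - _ = 6 * u ^+ 2 + 6 * (s * (s - 2)) + 4 * u + 8 * s - 8).
    by lra.
  by rewrite /q /p /m /mp /pm /pp /mm /qp /qm; ring.
rewrite -subr_ge0.
(* Products are grouped by total index. In the middle group the coefficient of [e * b] alone can be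
   negative, so the surplus of [c ^+ 2] is passed on to it. *)
rewrite (_ : _ - _ =
    (p ^+ 2 - pp * pm) * b ^+ 2 + pp * pm * (b ^+ 2 - c * a)
  + ((2 * p * q - pp * qm - qp * pm) * (c * b) + pp * qm * (c * b - e * a))
  + (pp * mm * (e * b - f * a) + (q ^+ 2 - mp * pm) * (c ^+ 2 - e * b)
     + (q ^+ 2 + 2 * p * m - mp * pm - pp * mm - qp * qm) * (e * b))
  + ((2 * q * m - mp * qm - qp * mm) * (e * c) + qp * mm * (e * c - f * b))
  + ((m ^+ 2 - mp * mm) * e ^+ 2 + mp * mm * (e ^+ 2 - f * c))); last by ring.
by do ![done | exact: sqr_ge0 | by rewrite subr_ge0
  | apply: addr_ge0 | apply: mulr_ge0].
Qed.

(* The leftmost nontrivial window, where some weights of quadratic_window_ineq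
   are negative but multiply zero entries. *)
Lemma quadratic_window_ineq_left (R : realFieldType) (K a b c : R) :
  2 <= K -> 0 <= a -> 0 <= b -> 0 <= c -> c * a <= b ^+ 2 ->
  (K - 1) * c * (3 * (K + 1) * a + (3 * K + 5) * b + (K + 1) * c)
  <= (2 * K * b + (K + 1) * c) ^+ 2.
Proof.
move=> K2 a0 b0 c0 h.
have k1 : 0 <= (K - 1) * (K + 1) by rewrite mulr_ge0; lra.
rewrite -subr_ge0.
rewrite (_ : _ - _ = 3 * ((K - 1) * (K + 1)) * (b ^+ 2 - c * a)
  + (K ^+ 2 + 3) * b ^+ 2 + (K ^+ 2 + 2 * K + 5) * (c * b)
  + (2 * K + 2) * c ^+ 2); last by ring.
by rewrite !addr_ge0 // mulr_ge0 ?sqr_ge0 ?subr_ge0 ?mulr_ge0 //; nra.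
Qed.

(** The coefficient of t^s in (1+t) theta (theta+k) ((1+t) W) + (k-1) W; the weight of [w s] factors
    because s(s+k) + k-1 = (s+1)(s+k-1). *)
Definition quadratic_window (k : rat) (w : int -> rat) (s : int) : rat :=
  (s%:~R + 1) * (s%:~R + k - 1) * w s
  + (s%:~R * (s%:~R + k) + (s%:~R - 1) * (s%:~R + k - 1)) * w (s - 1)
  + (s%:~R - 1) * (s%:~R + k - 1) * w (s - 2).

(** From s = 2 on the general inequality applies, and the last weight alone keeps the window
    positive up to s = n + 1. The windows at 0 and 1 are computed explicitly, since at 0 negative
    weights meet zero entries. *)
Lemma log_concave_on_quadratic_window n k w : (0 < n)%N -> 2 <= k ->
  log_concave_on n w -> log_concave_on n.+2 (quadratic_window k w).
Proof.
move=> n0 k2 wlcn; have [w0 wn wlc] := wlcn.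
have wz s : ~~ (0 <= s < n%:Z) -> w s = 0.
  by move=> sn; apply/eqP; rewrite -[_ == _]negbK wn.
have wp s : 0 <= s < n%:Z -> 0 < w s by move=> sn; rewrite lt_def w0 wn sn.
set R := quadratic_window k w.
have R_lt0 s : s < 0 -> R s = 0.
  by move=> s0; rewrite /R /quadratic_window !wz ?mulr0 ?addr0 //; lia.
have R0 : R 0 = (k - 1) * w 0.
  by rewrite /R /quadratic_window (wz (0 - 1)) // (wz (0 - 2)) //; ring.
have R1 : R 1 = 2 * k * w 1 + (k + 1) * w 0.
  by rewrite /R /quadratic_window (wz (1 - 2)) // subrr; ring.
have R2 : R (1 + 1) =
    3 * (k + 1) * w (1 + 1) + (3 * k + 5) * w 1 + (k + 1) * w 0.
  by rewrite /R /quadratic_window addrK (_ : 1 + 1 - 2 = 0) // intrD; ring.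
have cge s : 1 < s -> 2 <= s%:~R :> rat by move=> s1; rewrite (ler_int _ 2).
have R_ge s : 1 < s ->
    (s%:~R - 1) * (s%:~R + k - 1) * w (s - 2) <= R s.
  move=> /cge s1; rewrite /R /quadratic_window lerDr.
  by rewrite addr_ge0 // mulr_ge0 // ?addr_ge0 // mulr_ge0 //; lra.
split=> s.
- have [s1|s1] := ltP 1 s.
    apply: le_trans (R_ge s s1); have := cge s s1 => {}s1.
    by rewrite !mulr_ge0 //; lra.
  have [s0|s0] := ltP s 0; first by rewrite R_lt0.
  have [->|->] : s = 0 \/ s = 1 by lia.
    by rewrite R0 mulr_ge0 //; lra.
  by rewrite R1 addr_ge0 // mulr_ge0 //; lra.
- have [s1|s1] := ltP 1 s.
    have [sn|sn] := ltP s n.+2%:Z.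
      have := cge s s1 => c1; rewrite gt_eqF; first by lia.
      by apply: lt_le_trans (R_ge s s1); rewrite !mulr_gt0 ?wp //; try lra; lia.
    by rewrite /R /quadratic_window !wz ?mulr0 ?addr0 ?eqxx; lia.
  have [s0|s0] := ltP s 0; first by rewrite R_lt0 // eqxx; lia.
  have w00 : 0 < w 0 by apply: wp; lia.
  have [->|->] : s = 0 \/ s = 1 by lia.
    have k1 : 0 < k - 1 by lra.
    by rewrite R0 gt_eqF ?mulr_gt0 //; lia.
  have k1 : 0 < k + 1 by lra.
  rewrite R1 gt_eqF; first by lia.
  by rewrite ltr_wpDl ?mulr_ge0 ?mulr_gt0 //; lra.
have [s0|s0] := leP s 0.
  by rewrite (R_lt0 (s - 1)) ?mul0r ?sqr_ge0 //; lia.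
have [s1|s1] := leP s 1.
  have -> : s = 1 by lia.
  rewrite subrr R0 R1 R2; apply: quadratic_window_ineq_left => //.
  by have := wlc 1; rewrite subrr.
have h1 := wlc s; have h2 := wlc (s - 1); have h3 := wlc (s - 2).
have h4 := log_concave_on_gap3 wlcn (s - 1).
have h5 := log_concave_on_gap3 wlcn (s - 2).
have h6 := log_concave_on_gap4 wlcn (s - 1).
have e1 : s - 1 - 1 = s - 2 by lia.
have e2 : s - 1 + 2 = s + 1 by lia.
have e3 : s - 2 - 1 = s - 3 by lia.
have e4 : s - 2 + 1 = s - 1 by lia.
have e5 : s - 1 - 2 = s - 3 by lia.
have e6 : s + 1 - 2 = s - 1 by lia.
have e7 : s + 1 - 1 = s by lia.
rewrite ?(subrK, e1, e2, e3, e4, e5) in h2 h3 h4 h5 h6.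
have s2 : 2 <= s%:~R :> rat by exact: cge.
have u1 : 1 <= s%:~R + k - 1 :> rat by lra.
have := quadratic_window_ineq _ _ _ _ _ _ _ _ s2 u1
  (w0 _) (w0 _) (w0 _) (w0 _) (w0 _) h1 h2 h3 h4 h5 h6.
rewrite /R /quadratic_window e1 e5 e6 e7 addrK (rmorphB _ s 1) (rmorphD _ s 1) /= rmorph1.
move: (w _) (w _) (w _) (w _) (w _) => a b c e f.
by congr (_ <= _); ring.
Qed.

(** * Coefficients of the Chern product *)

(* The elementary symmetric polynomial e_k(0, ..., n - 1). *)
Fixpoint esym_iota (k n : nat) : nat :=
  match n, k with
  | n.+1, k.+1 => esym_iota k.+1 n + n * esym_iota k n
  | _, 0 => 1
  | 0, _ => 0
  end.

Lemma mcoeff_pihomog {n} {R : nzRingType} (p : {mpoly R[n]}) (m : 'X_{1..n}) :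
  (pihomog mdeg (mdeg m) p)@_m = p@_m.
Proof.
transitivity (\sum_(i <- msupp p) (p@_i *: 'X_[i])@_m); last first.
  by rewrite [in RHS](mpolyE p) raddf_sum.
rewrite pihomogE raddf_sum /= big_mkcond; apply: eq_bigr => i _.
by case: eqP => // im; rewrite mcoeffZ mcoeffX; case: eqP im => [->|]; rewrite ?mulr0.
Qed.

Lemma mcoeffMX_eq0 {n} {R : nzRingType} (p : {mpoly R[n]}) i (m : 'X_{1..n}) :
  m i = 0%N -> (p * 'X_i)@_m = 0.
Proof.
move=> mi; rewrite (mpolyE p) mulr_suml raddf_sum big1 //= => m' _.
rewrite -scalerAl -mpolyXD mcoeffZ mcoeffX; case: eqP => [mE|]; last by rewrite mulr0.
by move: mi; rewrite -mE mnmDE mnm1E eqxx addn1.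
Qed.

Definition mono2 (i j : nat) : 'X_{1..2} :=
  (U_(ord0 : 'I_2) *+ i + U_(ord_max : 'I_2) *+ j)%MM.

Lemma mono2_ord0 i j : mono2 i j ord0 = i.
Proof. by rewrite mnmDE !mulmnE !mnm1E mul1n mul0n addn0. Qed.

Lemma mono2_ord_max i j : mono2 i j ord_max = j.
Proof. by rewrite mnmDE !mulmnE !mnm1E mul1n mul0n. Qed.

Lemma mdeg_mono2 i j : mdeg (mono2 i j) = (i + j)%N.
Proof. by rewrite mdegD !mdegMn !mdeg1 !mul1n. Qed.

Lemma mono2P (m : 'X_{1..2}) i j :
  (m == mono2 i j) = (m ord_max == j) && (mdeg m == i + j)%N.
Proof.
apply/eqP/andP => [->|[/eqP mj /eqP md]].
  by rewrite mono2_ord_max mdeg_mono2 !eqxx.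
have m0 : m ord0 = i.
  move: md; rewrite mdegE !big_ord_recl big_ord0 addn0 (_ : lift _ _ = ord_max).
    by rewrite mj => /addIn.
  exact: val_inj.
apply/mnmP => a; have [->|->] : a = ord0 \/ a = ord_max.
- by case: a => [[|[|a]] ai] //; [left|right]; apply: val_inj.
- by rewrite mono2_ord0.
- by rewrite mono2_ord_max.
Qed.

(** The number of factors is separated from [d], so that induction on [n] keeps the weights [d - i]
    fixed. *)
Definition chern_prod (d n : nat) : {mpoly int[2]} :=
  \prod_(i < n) (1 + x1 *+ i + x2 *+ (d - i)).

Lemma mcoeffM_linear (p : {mpoly int[2]}) a b m :
  (p * (1 + x1 *+ a + x2 *+ b))@_m =
  p@_m + (p * x1)@_m *+ a + (p * x2)@_m *+ b.
Proof. by rewrite !mulrDr mulr1 !mulrnAr !mcoeffD !mcoeffMn. Qed.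

Lemma mcoeffMx1 (p : {mpoly int[2]}) i j :
  (p * x1)@_(mono2 i j) = if i is i'.+1 then p@_(mono2 i' j) else 0.
Proof.
case: i => [|i]; first by rewrite mcoeffMX_eq0 // mono2_ord0.
by rewrite /mono2 mulmS -addmA mcoeffMX.
Qed.

Lemma mcoeffMx2 (p : {mpoly int[2]}) i j :
  (p * x2)@_(mono2 i j) = if j is j'.+1 then p@_(mono2 i j') else 0.
Proof.
case: j => [|j]; first by rewrite mcoeffMX_eq0 // mono2_ord_max.
by rewrite /mono2 mulmS addmA (addmC _ U_(_)%MM) -addmA mcoeffMX.
Qed.

Lemma chern_prodS d n :
  chern_prod d n.+1 = chern_prod d n * (1 + x1 *+ n + x2 *+ (d - n)).
Proof. by rewrite /chern_prod big_ord_recr. Qed.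

Lemma esym_iota0 n : esym_iota 0 n = 1%N.
Proof. by case: n. Qed.

Lemma esym_iotaS k n :
  esym_iota k.+1 n.+1 = (esym_iota k.+1 n + n * esym_iota k n)%N.
Proof. by []. Qed.

(** At x2 = 0 the product becomes that of the factors 1 + i x1. *)
Lemma mcoeff_chern_prod0 d n k :
  (chern_prod d n)@_(mono2 k 0) = (esym_iota k n)%:R.
Proof.
elim: n k => [|n IH] k.
  rewrite /chern_prod big_ord0 mcoeff1 -mdeg_eq0 mdeg_mono2 addn0.
  by case: k.
rewrite chern_prodS mcoeffM_linear mcoeffMx1 mcoeffMx2 mul0rn addr0 IH.
case: k => [|k]; first by rewrite mul0rn addr0 !esym_iota0.
by rewrite IH esym_iotaS natrD mulnC natrM mulr_natr.
Qed.

(** Taking x2 from factor i gives (d - i) times e_k of the other numbers. Over all i, these e_k sum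
    to (n - k) e_k, and weighted by i to (k + 1) e_{k+1}. The bound on [n] makes the truncated
    [d - i] exact. *)
Lemma mcoeff_chern_prod1 d n k : (n <= d.+1)%N ->
  (chern_prod d n)@_(mono2 k 1) =
  d%:R * (n%:R - k%:R) * (esym_iota k n)%:R - k.+1%:R * (esym_iota k.+1 n)%:R.
Proof.
elim: n k => [|n IH] k nd.
  rewrite /chern_prod big_ord0 mcoeff1 -mdeg_eq0 mdeg_mono2 addn1 [RHS]/=.
  by case: k => [|k]; rewrite /= ?subrr !(mulr0, mul0r) subr0.
rewrite chern_prodS mcoeffM_linear mcoeffMx1 mcoeffMx2 IH 1?ltnW //.
rewrite mcoeff_chern_prod0 -[in LHS](mulr_natr _ (d - n)) natrB // esym_iotaS.
case: k => [|k].
  by rewrite mul0rn !esym_iota0 muln1; ring.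
by rewrite IH 1?ltnW // esym_iotaS; ring.
Qed.

(** * Expansions in the binomial basis *)

Definition binomial_sum (b : int -> rat) (d : nat) : rat :=
  \sum_(r < d.+1) b r%:Z * 'C(d, r)%:R.

(** From d C(d,r) = r C(d,r) + (r+1) C(d,r+1), with the index shifted in the second part. *)
Lemma binomial_sum_natl b d : d%:R * binomial_sum b d =
  binomial_sum (fun r => r%:~R * (b r + b (r - 1))) d.
Proof.
have -> : binomial_sum (fun r => r%:~R * (b r + b (r - 1))) d =
    \sum_(r < d.+1) r%:R * b r%:Z * 'C(d, r)%:R
    + \sum_(r < d.+1) r%:R * b (r%:Z - 1) * 'C(d, r)%:R.
  by rewrite -big_split /=; apply: eq_bigr => r _; rewrite mulrDr mulrDl.
(* The factor [r] kills the term at r = 0, where [b] is taken at -1. *)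
rewrite [X in _ = _ + X]big_ord_recl /= !mul0r add0r.
transitivity (\sum_(r < d.+1) r%:R * b r%:Z * 'C(d, r)%:R +
    \sum_(r < d.+1) r.+1%:R * b r%:Z * 'C(d, r.+1)%:R).
  rewrite -big_split mulr_sumr /=; apply: eq_bigr => r _.
  have /(congr1 (fun n => n%:R : rat)) : (d * 'C(d, r) = r * 'C(d, r) + r.+1 * 'C(d, r.+1))%N.
    by rewrite mul_bin_left -mulnDl subnKC // -ltnS.
  by rewrite natrD !natrM => h; rewrite mulrCA h; ring.
congr (_ + _); rewrite big_ord_recr /= bin_small // mulr0 addr0.
by apply: eq_bigr => r _; rewrite ?lift0 (_ : r.+1%:Z - 1 = r) //; lia.
Qed.

(** Pascal's rule: the forward difference in [d] shifts the coefficients by one. *)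
Lemma binomial_sumS b d :
  binomial_sum b d.+1 = binomial_sum b d + binomial_sum (fun r => b (r + 1)) d.
Proof.
rewrite {1}/binomial_sum big_ord_recl bin0.
under eq_bigr => r _ do rewrite lift0 binS natrD mulrDr.
rewrite big_split /= addrA; congr (_ + _); last first.
  by apply: eq_bigr => r _; rewrite ?lift0 (_ : r.+1%:Z = r%:Z + 1) //; lia.
rewrite big_ord_recr /= bin_small // mulr0 addr0.
by rewrite /binomial_sum big_ord_recl bin0.
Qed.

Lemma binomial_sumD b c d :
  binomial_sum (fun r => b r + c r) d = binomial_sum b d + binomial_sum c d.
Proof. by rewrite -big_split; apply: eq_bigr => r _; rewrite mulrDl. Qed.

Lemma binomial_sumZ x b d :
  binomial_sum (fun r => x * b r) d = x * binomial_sum b d.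
Proof. by rewrite mulr_sumr; apply: eq_bigr => r _; rewrite mulrA. Qed.

Lemma eq_binomial_sum b c d :
  (forall r : nat, b r%:Z = c r%:Z) -> binomial_sum b d = binomial_sum c d.
Proof. by move=> bc; apply: eq_bigr => r _; rewrite bc. Qed.

(** The system is unitriangular: the value at d = r determines [b r] from the earlier
    coefficients. *)
Lemma binomial_sum_inj b c :
  binomial_sum b =1 binomial_sum c -> forall r : nat, b r%:Z = c r%:Z.
Proof.
move=> bc r; elim/ltn_ind: r => r IH; have := bc r.
rewrite /binomial_sum !big_ord_recr /= binn !mulr1.
under eq_bigr => i _ do rewrite IH //.
by move/addrI.
Qed.

Lemma horner_binomial_poly r d : (binomial_poly r).[d%:R] = 'C(d, r)%:R.
Proof.
rewrite /binomial_poly hornerZ horner_prod.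
under eq_bigr => i _ do rewrite hornerXsubC.
have r0 : r`!%:R != 0 :> rat by rewrite pnatr_eq0 -lt0n fact_gt0.
apply: (mulfI r0); rewrite mulVKf // -natrM mulnC bin_ffact.
have [dr|rd] := ltnP d r.
  by rewrite ffact_small // (bigD1 (Ordinal dr)) //= subrr mul0r.
rewrite ffact_prod natr_prod; apply: eq_bigr => i _.
by rewrite natrB //; have := ltn_ord i; lia.
Qed.

Lemma horner_binomial_coefficients f b d :
  binomial_coefficients f b -> f.[d%:R] = binomial_sum b d.
Proof.
case=> _ [n [bn ->]]; rewrite horner_sum.
under eq_bigr => r _ do rewrite hornerZ horner_binomial_poly.
(* Both sums are padded with zero terms to the common length n + d + 1. *)
pose F (r : nat) := b r%:Z * 'C(d, r)%:R.
rewrite /binomial_sum (big_ord_widen (n + d.+1) F) ?leq_addr //.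
rewrite [RHS](big_ord_widen (n + d.+1) F) ?leq_addl //.
rewrite big_mkcond [RHS]big_mkcond; apply: eq_bigr => r _; rewrite /F.
case: (ltnP r n) => rn; case: (ltnP r d.+1) => rd //.
  by rewrite bin_small // mulr0.
by rewrite bn // mul0r.
Qed.

(** * Elementary symmetric polynomials and associated Stirling numbers *)

(* Coefficients of e_j(0, ..., d) in the binomial basis in d. *)
Fixpoint esym_bin (j : nat) (r : int) : rat :=
  if j is i.+1 then r%:~R * esym_bin i (r - 1) + (r%:~R - 1) * esym_bin i (r - 2)
  else (r == 0)%:R.

Lemma esym_bin_lt0 j r : r < 0 -> esym_bin j r = 0.
Proof.
elim: j r => [|j IH] r r0 /=; first by rewrite lt_eqF.
by rewrite !IH ?mulr0 ?addr0 //; lia.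
Qed.

(** Adjoining the number d + 1 changes e_{j+1} by (d + 1) e_j(0, ..., d). Expressed through the
    forward difference and multiplication by [d], this is the recurrence of [esym_bin]. *)
Lemma esym_iotaE j d : (esym_iota j d.+1)%:R = binomial_sum (esym_bin j) d.
Proof.
elim: j d => [|j IH] d.
  by rewrite /binomial_sum big_ord_recl /= bin0 mul1r big1 ?addr0 // => i _; rewrite mul0r.
elim: d => [|d IHd].
  by rewrite /binomial_sum big_ord_recl big_ord0 /= !esym_bin_lt0 // !mulr0 addr0 mul0r addr0.
rewrite binomial_sumS -IHd [LHS]natrD -/(esym_iota _ _); congr (_ + _).
rewrite -/(esym_iota j d.+1) natrM IH.
rewrite -addn1 natrD mulrDl mul1r binomial_sum_natl -binomial_sumD.
apply: eq_binomial_sum => r /=.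
rewrite addrK intrD (_ : r%:Z + 1 - 2 = r%:Z - 1); last by lia.
by ring.
Qed.

(* The number of derangements of j + s + 2 points having s + 1 cycles. *)
Fixpoint assoc_stirling1 (j : nat) (s : int) : rat :=
  if j is i.+1 then (s%:~R + i%:R + 2) * (assoc_stirling1 i s + assoc_stirling1 i (s - 1))
  else (s == 0)%:R.

(** Sorting the permutations of d + 1 points with d - j cycles by their moved points gives
    e_{j+1}(1..d) = sum_s v_j(s) C(d+1, j+s+2), and Pascal's rule splits each binomial in two. The
    proof compares recurrences instead. *)
Lemma esym_binS j r :
  esym_bin j.+1 r = assoc_stirling1 j (r - j%:Z - 1) + assoc_stirling1 j (r - j%:Z - 2).
Proof.
elim: j r => [|j IH] r.
  rewrite /= subr0 !subr_eq0.
  have [->|_] := eqVneq r 1; first by rewrite /=; ring.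
  by have [->|_] := eqVneq r 2; rewrite /=; ring.
rewrite -[LHS]/(r%:~R * esym_bin j.+1 (r - 1) + (r%:~R - 1) * esym_bin j.+1 (r - 2)).
rewrite !IH /=.
have -> : r - 1 - j%:Z - 1 = r - j.+1%:Z - 1 by lia.
have -> : r - 1 - j%:Z - 2 = r - j.+1%:Z - 2 by lia.
have -> : r - 2 - j%:Z - 1 = r - j.+1%:Z - 2 by lia.
have -> : r - 2 - j%:Z - 2 = r - j.+1%:Z - 2 - 1 by lia.
have -> : r - j.+1%:Z - 1 - 1 = r - j.+1%:Z - 2 by lia.
rewrite !intrB -[j.+1%:~R]/(j.+1%:R) -natr1.
by move: (assoc_stirling1 _ _) (assoc_stirling1 _ _) (assoc_stirling1 _ _) => x y z; ring.
Qed.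

Lemma log_concave_on_assoc_stirling1 j : log_concave_on j.+1 (assoc_stirling1 j).
Proof.
elim: j => [|j IH] /=.
  split=> s /=.
  - by case: (s == 0).
  - by rewrite pnatr_eq0 eqb0 negbK; lia.
  - have [s0|s0] := eqVneq s 0; first by rewrite s0 /= expr1n.
    by case: eqVneq; case: eqVneq; rewrite ?mulr0 ?mul0r ?expr0n //; lia.
(* The affine weight is positive for s >= 0, and its square exceeds the product of its neighbours by
   1. *)
apply: log_concave_on_scale => [s s0|s s0|].
- have s1 : 0 <= s%:~R :> rat by rewrite ler0z.
  by have := ler0n rat j; lra.
- by rewrite (rmorphD _ s 1) (rmorphB _ s 1) /=; lra.
- exact: log_concave_on_add_shift.
Qed.

(** * Two-variable Schur coefficients by counting tableaux *)

Lemma card_cell2 (a b : nat) : (b <= a)%N -> #|{: cell [:: a; b]}| = (a + b)%N.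
Proof.
move=> ba; rewrite card_sig -sum1_card.
rewrite (eq_bigl (fun c : 'I_2 * 'I_a => xpredT c.1 && (c.2 < nth 0 [:: a; b] c.1)%N)) //.
rewrite -(pair_big_dep xpredT (fun (i : 'I_2) (c : 'I_a) => (c < nth 0 [:: a; b] i)%N)
  (fun _ _ => 1%N)) /=.
rewrite big_ord_recl big_ord_recl big_ord0 /= addn0.
by rewrite -!(big_ord_widen a (fun=> 1%N)) // !sum1_card !card_ord.
Qed.

Lemma semistandardP (n : nat) (la : seq nat) (T : {ffun cell la -> 'I_n}) :
  semistandard T <-> forall u v : cell la,
    ((val u).1 = (val v).1 -> ((val u).2 <= (val v).2)%N -> (T u <= T v)%N) /\
    ((val u).2 = (val v).2 -> ((val u).1 < (val v).1)%N -> (T u < T v)%N).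
Proof.
split=> [/forallP ss u v|ss].
  have /forallP /(_ v) /andP[h1 h2] := ss u; split=> e l.
    by move/implyP: h1; apply; rewrite e eqxx.
  by move/implyP: h2; apply; rewrite e eqxx.
apply/forallP => u; apply/forallP => v; have [h1 h2] := ss u v.
by apply/andP; split; apply/implyP => /andP[/eqP e l]; [apply: h1|apply: h2].
Qed.

(** Entries are 0 or 1, so this is the exponent of [x2] in the tableau monomial. *)
Definition content1 (la : seq nat) (T : {ffun cell la -> 'I_2}) : nat :=
  \sum_u (T u : nat).

Lemma mcoeff_schur2 (a b c d : nat) : (b <= a)%N -> (a + b = c + d)%N ->
  (schur 2 rat [:: a; b])@_(mono2 c d) =
  #|[pred T : {ffun cell [:: a; b] -> 'I_2} | semistandard T & content1 _ T == d]|%:R.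
Proof.
move=> ba abcd; rewrite /schur raddf_sum -sum1_card natr_sum /= big_mkcondr /=.
apply: eq_bigr => T _; rewrite mprodXE mcoeffX mono2P mdeg_sum.
rewrite (eq_bigr (fun=> 1%N)) => [|u _]; last by rewrite mdeg1.
rewrite sum1_card card_cell2 // abcd eqxx andbT mnm_sumE.
rewrite (eq_bigr (fun u => T u : nat)) => [|u _].
  by rewrite -/(content1 [:: a; b] T); case: eqP.
by rewrite mnm1E; case: (T u) => [[|[|]]].
Qed.

Lemma cell2_lt {a b : nat} (u : cell [:: a; b]) :
  ((val u).2 < if (val u).1 == ord0 then a else b)%N.
Proof.
by have := valP u; case: (val u) => [[[|[|i]] ui] c].
Qed.

Lemma cell2_row1 {a b : nat} (u : cell [:: a; b]) : (val u).1 != ord0 -> (val u).1 = ord_max.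
Proof. by case: (val u) => [[[|[|i]] ui] c] // _; apply: val_inj. Qed.

Lemma cell2_row0 {a b : nat} (u : cell [:: a; b]) : b = 0%N -> (val u).1 = ord0.
Proof.
have := cell2_lt u; case: eqP => // _ /(leq_ltn_trans (leq0n _)) b_gt0 b0.
by rewrite b0 in b_gt0.
Qed.

Lemma cell2_ex0 {a b : nat} (c : nat) : (c < a)%N ->
  exists u : cell [:: a; b], (val u).1 = ord0 /\ (val u).2 = c :> nat.
Proof.
move=> ca.
by exists (exist (fun c : 'I_2 * 'I_a => (c.2 < nth 0 [:: a; b] c.1)%N)
  (ord0, Ordinal ca) ca).
Qed.

Lemma cell2_ex1 {a b : nat} (ba : (b <= a)%N) (c : nat) : (c < b)%N ->
  exists u : cell [:: a; b], (val u).1 = ord_max /\ (val u).2 = c :> nat.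
Proof.
move=> cb; have ca := leq_trans cb ba.
by exists (exist (fun c : 'I_2 * 'I_a => (c.2 < nth 0 [:: a; b] c.1)%N)
  (ord_max, Ordinal ca) cb).
Qed.

Lemma cell2_inj {a b : nat} (u v : cell [:: a; b]) :
  (val u).1 = (val v).1 -> (val u).2 = (val v).2 :> nat -> u = v.
Proof.
move=> e1 e2; apply: val_inj.
by case: (val u) (val v) e1 e2 => [i c] [i' c'] /= -> /val_inj ->.
Qed.

(** The cell above carries a strictly smaller entry, which leaves only 1. *)
Lemma semistandard_row1 {a b : nat} (ba : (b <= a)%N)
    (T : {ffun cell [:: a; b] -> 'I_2}) (u : cell [:: a; b]) :
  semistandard T -> (val u).1 = ord_max -> T u = ord_max.
Proof.
move=> /semistandardP ss u1.
have [v [v1 v2]] := cell2_ex0 (b := b) _ (ltn_ord (val u).2).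
have [_ /(_ (val_inj v2))] := ss v u; rewrite v1 u1 => /(_ isT) vu.
apply: val_inj => /=; move: vu (ltn_ord (T u)).
by case: (T u : nat) => [|[|]].
Qed.

Lemma content1_ge {a b : nat} (ba : (b <= a)%N) (T : {ffun cell [:: a; b] -> 'I_2}) :
  semistandard T -> (b <= content1 _ T)%N.
Proof.
move=> ss; pose P := [pred u : cell [:: a; b] | (val u).1 == ord_max].
apply: (@leq_trans (\sum_(u in P) T u)); last first.
  by rewrite /content1 [leqRHS](bigID P) leq_addr.
rewrite (eq_bigr (fun=> 1%N)) => [|u /eqP u1]; last by rewrite (semistandard_row1 ba).
(* The complement of the second row embeds into the [a] columns, so at least [b] of the a + b cells
   remain. *)
rewrite sum1_card -(leq_add2r #|[predC P]|) cardC card_cell2 // addnC leq_add2r.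
rewrite -[leqRHS](card_ord a) -(card_in_image (f := fun u : cell [:: a; b] => (val u).2)).
  exact: max_card.
move=> u v; rewrite !inE => u1 v1 uv; apply: cell2_inj; last by rewrite uv.
by case: (eqVneq (val u).1 ord0) (eqVneq (val v).1 ord0) =>
  [->|/cell2_row1 e] [->|/cell2_row1 e'] //; move: u1 v1; rewrite ?e ?e'.
Qed.

Lemma card_semistandard0 (a b : nat) (ba : (b <= a)%N) :
  #|[pred T : {ffun cell [:: a; b] -> 'I_2} | semistandard T & content1 _ T == 0%N]|
  = (b == 0%N).
Proof.
have [b0|b0] := eqVneq b 0%N; last first.
  apply: eq_card0 => T; rewrite !inE; apply/negP => /andP[/(content1_ge ba) ss /eqP]; lia.
apply: (@eq_card1 _ [ffun => ord0]) => T; rewrite !inE.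
apply/andP/eqP => [[_]|->].
  rewrite sum_nat_eq0 => /forallP h; apply/ffunP => u; rewrite ffunE.
  by apply: val_inj; apply/eqP; exact: h.
split; last by rewrite /content1 big1 // => u _; rewrite ffunE.
apply/semistandardP => u v; rewrite !ffunE; split=> // _ uv.
by move: uv; rewrite (cell2_row0 v b0).
Qed.

(** The single 1 is forced to the end of the first row if b = 0, and into the only cell of the
    second row if b = 1; [w] below is that cell. *)
Lemma card_semistandard1 (a b : nat) (ba : (b <= a)%N) : (0 < a)%N ->
  #|[pred T : {ffun cell [:: a; b] -> 'I_2} | semistandard T & content1 _ T == 1%N]|
  = (b <= 1)%N.
Proof.
move=> a0.
have [b1|b1] := leqP b 1; last first.
  by apply: eq_card0 => T; rewrite !inE; apply/negP => /andP[/(content1_ge ba) ss /eqP]; lia.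
have [w [w1 w2]] : exists w : cell [:: a; b],
   (val w).1 = (if b == 0 then ord0 else ord_max) /\
   (val w).2 = (if b == 0 then a.-1 else 0) :> nat.
  case: eqP => b0; first by apply: cell2_ex0; lia.
  by apply: cell2_ex1 => //; lia.
apply: (@eq_card1 _ [ffun u => if u == w then ord_max else ord0]) => T; rewrite !inE.
apply/andP/eqP => [[ss T1]|->].
  have Tw : T w = ord_max.
    case: (eqVneq b 0%N) w1 w2 => b0 w1 w2; last exact: (semistandard_row1 ba).
    (* For b = 0, some entry is 1, and weak increase along the row carries it to the last cell. *)
    have [u Tu] : exists u, T u != ord0.
      apply/existsP; apply: contraTT T1 => /existsPn h.
      by rewrite /content1 big1 // => u _; move/negPn/eqP: (h u) => ->.
    move/semistandardP: ss => /(_ u w) [+ _].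
    have := ltn_ord (val u).2; rewrite (cell2_row0 u b0) w1 w2.
    move=> u2 /(_ erefl); rewrite -ltnS prednK // => /(_ u2).
    move=> uw; apply: val_inj => /=; move: Tu uw (ltn_ord (T w)).
    rewrite -val_eqE /=; case: (T w : nat) => [|[|]] //.
    by rewrite leqn0 => /negPf ->.
  move: T1; rewrite /content1 (bigD1 w) //= Tw eqSS.
  rewrite sum_nat_eq0 => /forallP h; apply/ffunP => u; rewrite ffunE.
  case: eqVneq => [->//|uw]; apply: val_inj; apply/eqP.
  by have /implyP := h u; apply.
split; last first.
  by rewrite /content1 (bigD1 w) //= big1 ?ffunE ?eqxx // => u /negPf uw; rewrite ffunE uw.
apply/semistandardP => u v; rewrite !ffunE; split=> uv l.
  case: eqVneq => [uw|//]; suff -> : v = w by rewrite eqxx.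
  apply: cell2_inj; rewrite -?uv ?uw //.
  move: l; rewrite uw w2; have := cell2_lt v; rewrite -uv uw w1.
  by case: (b == 0%N) => /=; lia.
(* A strict column pair puts [v] in the second row, so b = 1 and [v] is [w]. *)
have vmax : (val v).1 = ord_max.
  by apply: cell2_row1; apply: contraTneq l => ->.
have v2 : ((val v).2 < b)%N by have := cell2_lt v; rewrite vmax.
have b0 : b != 0%N by lia.
rewrite (negPf b0) in w1 w2.
have -> : v = w.
  apply: cell2_inj; first by rewrite vmax w1.
  rewrite w2; lia.
rewrite eqxx; case: eqVneq => // uw.
by move: l; rewrite uw w1 vmax.
Qed.

(** * The coefficient of the second Schur polynomial *)

Lemma mcoeff_chern k d m :
  mdeg m = k -> (chern k d)@_m = (chern_prod d d.+1)@_m.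
Proof. by move=> <-; exact: mcoeff_pihomog. Qed.

(** For i = 0, 1 the coefficient of x1^(k+2-i) x2^i is the sum of the values of [a j] over j <= i,
    so the value of [a 1] is the difference of the two. *)
Lemma schur_coefficient1 k d (a : nat -> {poly rat}) :
  schur_coefficients k.+2 a ->
  (a 1%N).[d%:R] = d%:R * (d%:R - k%:R) * (esym_iota k.+1 d.+1)%:R
                   - k.+3%:R * (esym_iota k.+2 d.+1)%:R.
Proof.
move=> /(_ d) ha.
have coef i : (i <= 1)%N -> ((chern_prod d d.+1)@_(mono2 (k.+2 - i) i))%:~R =
    \sum_(j < k.+2./2.+1) (a j).[d%:R] * (j <= i)%:R.
  move=> i1; have := congr1 (mcoeff (mono2 (k.+2 - i) i)) ha.
  rewrite mcoeff_map_mpoly mcoeff_chern => [->|]; last first.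
    by rewrite mdeg_mono2 subnK //; lia.
  rewrite raddf_sum /=; apply: eq_bigr => j _.
  have jk : (j <= k.+2 - j)%N by have := ltn_ord j; rewrite ltnS; lia.
  have a_gt0 : (0 < k.+2 - j)%N by lia.
  rewrite mcoeffZ mcoeff_schur2 //; last by lia.
  case: i i1 => [|[|//]] _; first by rewrite card_semistandard0 ?leqn0.
  by rewrite card_semistandard1.
have := coef 1%N isT; have := coef 0%N isT.
rewrite subn0 subn1 mcoeff_chern_prod0 mcoeff_chern_prod1 //.
set e1 := esym_iota k.+1 _; set e2 := esym_iota k.+2 _.
rewrite [k.+2./2.+1]/= !(big_ord_recl k./2.+1) !(big_ord_recl k./2) /=.
rewrite !big1 => [|i _]; last by rewrite mulr0.
move=> h0 h1.
have -> : (a 1%N).[d%:R] =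
    (d%:R * (d.+1%:R - k.+1%:R) * e1%:R - k.+2%:R * e2%:R)%:~R - e2%:R%:~R.
  by rewrite h0 h1; ring.
by ring.
Qed.

(** The coefficient of t^r in t^(k+1) (1+t) U, for Schur degree [k.+2]. *)
Definition schur_binomial_coefficient1 (k : nat) (r : int) : rat :=
  quadratic_window k.+2%:R (assoc_stirling1 k) (r - k%:Z - 1)
  + quadratic_window k.+2%:R (assoc_stirling1 k) (r - k%:Z - 1 - 1).

(** Reading d (d - k) E as d (d E - k E), each factor d acts on coefficients; what remains is an
    identity in four consecutive associated Stirling numbers. *)
Lemma binomial_sum_schur1 k d :
  binomial_sum (schur_binomial_coefficient1 k) d =
  d%:R * (d%:R - k%:R) * (esym_iota k.+1 d.+1)%:R
  - k.+3%:R * (esym_iota k.+2 d.+1)%:R.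
Proof.
pose E := esym_bin k.+1.
rewrite !esym_iotaE -/E -mulrA mulrBl binomial_sum_natl.
rewrite -mulNr -[- _ * _]binomial_sumZ -binomial_sumD binomial_sum_natl.
rewrite -mulNr -binomial_sumZ -binomial_sumD.
apply: eq_binomial_sum => r.
rewrite -[esym_bin k.+2 r]/(r%:~R * E (r%:Z - 1) + (r%:~R - 1) * E (r%:Z - 2)).
rewrite /E !esym_binS /schur_binomial_coefficient1 /quadratic_window.
have [s sE] : exists s : int, r%:Z = s + k%:Z + 1 by exists (r%:Z - k%:Z - 1); lia.
rewrite sE.
have -> : s + k%:Z + 1 - 1 - 1 = s + k%:Z + 1 - 2 by lia.
have -> : s + k%:Z + 1 - k%:Z - 1 = s by lia.
have -> : s + k%:Z + 1 - k%:Z - 2 = s - 1 by lia.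
have -> : s + k%:Z + 1 - 1 - k%:Z - 1 = s - 1 by lia.
have -> : s + k%:Z + 1 - 1 - k%:Z - 2 = s - 2 by lia.
have -> : s + k%:Z + 1 - 2 - k%:Z - 1 = s - 2 by lia.
have -> : s + k%:Z + 1 - 2 - k%:Z - 2 = s - 3 by lia.
have -> : s - 1 - 1 = s - 2 by lia.
have -> : s - 1 - 2 = s - 3 by lia.
move: (assoc_stirling1 k s) (assoc_stirling1 k (s - 1))
  (assoc_stirling1 k (s - 2)) (assoc_stirling1 k (s - 3)) => a b c e.
by ring.
Qed.

Lemma log_concave_on_shift n w m : log_concave_on n w ->
  no_internal_zeroes (fun r => w (r - m)) /\
  forall r : int, w (r - 1 - m) * w (r + 1 - m) <= w (r - m) ^+ 2.
Proof.
case=> _ wn wlc; split=> [i j l ij jl|r].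
  by rewrite !wn; lia.
by have := wlc (r - m); rewrite ![_ - m + _]addrAC.
Qed.

Theorem theorem5p4
  (A : nat -> nat -> {poly rat})
  (B : nat -> nat -> int -> rat)
  (hA : forall k : nat, schur_coefficients k (A k))
  (hB : forall k j : nat, (j <= k./2)%N ->
        binomial_coefficients (A k j) (B k j)) :
  (forall k r : nat, (2 <= k)%N ->
     B k 1%N (r%:Z - 1) * B k 1%N (r%:Z + 1) <= B k 1%N r%:Z ^+ 2) /\
  (forall k : nat, (2 <= k)%N -> binomially_log_concave (A k 1%N)).
Proof.
have Bk k : exists n w, log_concave_on n w /\ B k.+2 1%N =1 (fun r => w (r - k%:Z - 1)).
  (* The Stirling row has k + 1 entries, the window adds two and the factor 1 + t one. *)
  exists k.+4, (fun s => quadratic_window k.+2%:R (assoc_stirling1 k) s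
    + quadratic_window k.+2%:R (assoc_stirling1 k) (s - 1)).
  have lc : log_concave_on k.+4 (fun s => quadratic_window k.+2%:R (assoc_stirling1 k) s
    + quadratic_window k.+2%:R (assoc_stirling1 k) (s - 1)).
    apply: log_concave_on_add_shift => //.
    apply: log_concave_on_quadratic_window => //; first by rewrite ler_nat.
    exact: log_concave_on_assoc_stirling1.
  split=> // r; have h := hB k.+2 1%N isT.
  (* Values at natural [d] see only coefficients with r >= 0, so negative indices are settled by the
     support. *)
  have [r0|r0] := ltP r 0.
    have [_ wn _] := lc; rewrite h.1 //; apply/esym/eqP.
    by rewrite -[_ == _]negbK wn; lia.
  case: r r0 => // r _.
  (* Both sequences evaluate to A_{k+2,1}(d) at every natural d, hence agree. *)
  apply: (binomial_sum_inj _ (schur_binomial_coefficient1 k)) => d.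
  by rewrite binomial_sum_schur1 -(horner_binomial_coefficients _ _ _ h) (schur_coefficient1 k).
have lc k : (2 <= k)%N -> no_internal_zeroes (B k 1%N) /\
    forall r : int, B k 1%N (r - 1) * B k 1%N (r + 1) <= B k 1%N r ^+ 2.
  case: k => [|[|k]] // _; have [n [w [wlc wB]]] := Bk k.
  have [nz ineq] := log_concave_on_shift _ _ (k%:Z + 1) wlc.
  split=> [i j l ij jl|r].
    by have := nz i j l ij jl; rewrite !wB !opprD !addrA.
  by have := ineq r; rewrite !wB !opprD !addrA.
split=> [k r k2|k k2]; first exact: (lc k k2).2.
exists (B k 1%N); have [nz ineq] := lc k k2; split=> //.
by apply: hB; rewrite half_gt0.
Qed.
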